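(* If $f\in W(\pi)$, then, writing $z=x+iy$ with $x,y\in\mathbb R$, $$\lim_{|z|\to\infty}\frac{|f(z)|}{\sqrt{\dfrac{\sin\pi(z-\overline z)}{\pi(z-\overline z)}}}=\lim_{|z|\to\infty}\frac{|f(z)|}{\sqrt{\dfrac{e^{2\pi y}-e^{-2\pi y}}{4\pi y}}}=0 .$$
   Context: $W(\pi)$ is the Paley-Wiener space: the space of entire functions $f$ of the form $$f(z)=\frac1{2\pi}\int_{-\pi}^{\pi}F(t)e^{-izt}\,dt,\qquad z\in\mathbb C,$$ with $F\in L^2([-\pi,\pi])$. Equivalently, it consists of the entire functions with $|f(z)|\le C\exp(\pi|z|)$ as $|z|\to\infty$ for some constant $C$, and $\int_{\mathbb R}|f(x)|^2dx<\infty$. When $y=0$ the expressions $\frac{\sin\pi(z-\overline z)}{\pi(z-\overline z)}$ and $\frac{e^{2\pi y}-e^{-2\pi y}}{4\pi y}$ are understood as their limiting value $1$. The limit is over $z\in\mathbb C$ with $|z|\to\infty$ in an unrestricted manner. *)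

(* Defs.v *)
From HB Require Import structures.
From mathcomp Require Import all_boot all_order all_algebra.
From mathcomp Require Import complex.
From mathcomp Require Import all_classical all_reals all_analysis.

Set Implicit Arguments.
Unset Strict Implicit.
Unset Printing Implicit Defensive.

Import Order.TTheory GRing.Theory Num.Theory.
Import numFieldNormedType.Exports.

Local Open Scope classical_set_scope.
Local Open Scope ring_scope.
Local Open Scope complex_scope.

(* The library's norm on R[i] takes its values in R[i]; this is |z| as an
   element of R. *)
Notation cmod := ComplexField.Normc.normc.

Section ComplexFunctions.
Context {R : realType}.
Implicit Types (z w : R[i]).

(* exp(x + iy) = e^x (cos y + i sin y) *)
Definition cexp z : R[i] :=
  let: x +i* y := z in (expR x)%:C * (cos y +i* sin y).

Definition csin z : R[i] := (cexp ('i * z) - cexp (- ('i * z))) / (2 * 'i).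

(* sin (pi w) / (pi w), with its limiting value at w = 0 *)
Definition csinc w : R[i] :=
  if w == 0 then 1 else csin (pi%:C * w) / (pi%:C * w).

(* (e^(2 pi y) - e^(- 2 pi y)) / (4 pi y), with its limiting value at y = 0 *)
Definition sinhc (y : R) : R :=
  if y == 0 then 1
  else (expR (2 * pi * y) - expR (- (2 * pi * y))) / (4 * pi * y).

(* The filter of |z| --> +oo in the complex plane. *)
Definition cinfty : set_system R[i] :=
  filter_from [set: R] (fun M => [set z : R[i] | M < cmod z]).

Lemma cinfty_proper : ProperFilter cinfty.
Proof.
apply: filter_from_proper; last first.
  move=> M _; exists (`|M| + 1)%:C => /=.
  rewrite expr0n /= addr0 sqrtr_sqr ger0_norm ?addr_ge0//.
  by rewrite (le_lt_trans (ler_norm M))// ltrDl.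
apply: filter_from_filter; first by exists 0.
move=> M N _ _; exists (Num.max M N) => //= z /=.
by rewrite gt_max => /andP[].
Qed.

End ComplexFunctions.

#[export] Existing Instance cinfty_proper.

Section PaleyWiener.
Context {R : realType}.
Local Notation mu := (@lebesgue_measure R).
Local Notation Re := complex.Re.
Local Notation Im := complex.Im.
Local Notation Ipi := (`[- pi, pi]%classic : set R).

(* Lebesgue integral of a complex-valued function, by real and imaginary
   parts; meaningful when both parts are integrable on D. *)
Definition cintegral (D : set R) (g : R -> R[i]) : R[i] :=
  (\int[mu]_(t in D) Re (g t)) +i* (\int[mu]_(t in D) Im (g t)).

(* A representative of an element of L^2([-pi, pi]): its values outside
   [-pi, pi] are irrelevant, and measurability is Borel measurability, which
   every L^2 class has a representative satisfying. *)
Definition L2_pi (F : R -> R[i]) : Prop :=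
  [/\ measurable_fun Ipi (fun t => Re (F t)),
      measurable_fun Ipi (fun t => Im (F t)) &
      (\int[mu]_(t in Ipi) ((cmod (F t)) ^+ 2)%:E < +oo)%E].

Definition paley_wiener : set (R[i] -> R[i]) :=
  [set f : R[i] -> R[i] | exists2 F : R -> R[i], L2_pi F & forall z : R[i],
    f z = (2 * pi)^-1%:C *
          cintegral Ipi (fun t => F t * cexp (- 'i * z * t%:C))].

End PaleyWiener.

(* Main.v *)
Require Import Defs.
From HB Require Import structures.
From mathcomp Require Import all_boot all_order all_algebra.
From mathcomp Require Import complex.
From mathcomp Require Import all_classical all_reals all_analysis.
From mathcomp Require Import measurable_realfun.
From mathcomp Require Import ring lra.

Import Order.TTheory GRing.Theory Num.Theory.
Import numFieldNormedType.Exports.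

Local Open Scope classical_set_scope.
Local Open Scope ring_scope.
Local Open Scope complex_scope.

(* The Cauchy-Schwarz inequality bounds |f(z)| by a constant times
   |F|_2 (int_(-pi)^pi e^(2yt) dt)^(1/2) = |F|_2 sqrt (2 pi sinhc y), so the
   set of F for which the quotient tends to 0 is a closed subspace of
   L^2([-pi, pi]).  It contains the indicators of intervals, for which |f(z)|
   is at most a constant times e^(pi |y|) / |z|, while
   e^(2 pi |y|) <= (1 + 4 pi |y|) sinhc y.  By the pi-lambda theorem it
   contains the indicators of Borel sets, hence everything.  The complex
   integral is split into real ones of the form
   int u(t) e^(yt) cos(xt + th) dt, the sine being cos(. - pi/2). *)

Set Implicit Arguments.
Unset Strict Implicit.

(** * The weight [sinhc] and the real exponential kernel *)

Section Kernel.
Context {R : realType}.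
Implicit Types (x y t th : R).
Local Notation mu := (@lebesgue_measure R).
Local Notation Ipi := (`[- pi, pi]%classic : set R).

(** By evenness take [y > 0]. With [E = e^(2 pi y)] and [a = 4 pi y], clearing denominators leaves
    [(E^2 - (1 + a)) / E >= 0], which is [e^a >= 1 + a]. *)
Lemma sinhc_lower_bound y :
  expR (2 * (pi * `|y|)) <= sinhc y * (1 + 4 * pi * `|y|).
Proof.
have pi0 := @pi_gt0 R.
wlog y0 : y / 0 <= y.
  move=> H; have [/H//|yl0] := leP 0 y.
  have sN : sinhc (- y) = sinhc y.
    rewrite /sinhc oppr_eq0; case: ifP => // _.
    by rewrite !mulrN opprK -opprB invrN mulrN mulNr opprK.
  by rewrite -normrN -sN; apply: H; rewrite oppr_ge0 ltW.
rewrite ger0_norm// /sinhc; have [->|yn0] := eqVneq y 0.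
  by rewrite !mulr0 expR0 addr0 mul1r.
have {}y0 : 0 < y by rewrite lt_def yn0.
have a0 : 0 < 4 * pi * y by rewrite !mulr_gt0.
have /= H := expR_ge1Dx (4 * pi * y).
rewrite mulrAC ler_pdivlMr// mulrA.
set E := expR (2 * pi * y).
have E0 : 0 < E by exact: expR_gt0.
have EE : expR (4 * pi * y) = E ^+ 2.
  by rewrite /E -expRM_natl; congr expR; ring.
rewrite EE in H; rewrite expRN -/E -subr_ge0.
have -> : (E - E^-1) * (1 + 4 * pi * y) - E * (4 * pi * y) =
  (E ^+ 2 - (1 + 4 * pi * y)) / E by field; lra.
by rewrite divr_ge0// ?subr_ge0// ltW.
Qed.

Lemma sinhc_gt0 y : 0 < sinhc y.
Proof.
have h : 0 < 1 + 4 * pi * `|y| by rewrite ltr_wpDr ?mulr_ge0// ltW// pi_gt0.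
rewrite -(pmulr_lgt0 _ h); apply: lt_le_trans (sinhc_lower_bound y).
exact: expR_gt0.
Qed.

(** For [z = x + iy], [e^(-izt) = kern x y 0 t - i kern x y (- pi / 2) t]; the free phase lets one
    estimate serve both parts. *)
Definition kern x y th t : R := expR (y * t) * cos (x * t + th).

Lemma continuous_kern x y th : continuous (kern x y th).
Proof.
move=> t; apply: cvgM.
  by apply: continuous_comp; [exact: mulrl_continuous|exact: continuous_expR].
apply: continuous_comp; last exact: continuous_cos.
by apply: cvgD; [exact: mulrl_continuous|exact: cvg_cst].
Qed.

Lemma Rintegral_FTC (f F : R -> R) (a b : R) : a <= b -> continuous f ->
  (forall t, is_derive t (1 : R) F (f t)) ->
  \int[mu]_(t in `[a, b]) f t = F b - F a.
Proof.
rewrite le_eqVlt => /predU1P[<- _ _|ab cf dF].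
  by rewrite set_itv1 Rintegral_set1 subrr.
rewrite /Rintegral (@continuous_FTC2 _ f F)// ?EFinB//.
- exact: continuous_subspaceT.
- have cF t : {for t, continuous F}.
    by apply: differentiable_continuous; apply/derivable1_diffP; case: (dF t).
  split; first by move=> t _; case: (dF t).
  + exact/cvg_at_right_filter/cF.
  + exact/cvg_at_left_filter/cF.
- by move=> t _; rewrite derive1E; exact: derive_val.
Qed.

(** Since [|kern x y th t|^2 <= e^(2yt)], this bounds the squared L^2 norm of the kernel by
    [2 pi sinhc y], whatever [x] and [th] are. *)
Lemma Rintegral_expR2 y :
  \int[mu]_(t in Ipi) expR (2 * y * t) = 2 * pi * sinhc y.
Proof.
have pi0 := @pi_gt0 R.
have pp : - pi <= pi :> R by lra.
rewrite /sinhc; have [->|y0] := eqVneq y 0.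
  have -> : \int[mu]_(t in Ipi) expR (2 * 0 * t) = \int[mu]_(t in Ipi) 1.
    by apply: eq_Rintegral => t _; rewrite mulr0 mul0r expR0.
  rewrite (@Rintegral_FTC _ id)//; first by ring.
  by move=> ?; exact: cvg_cst.
pose F t := (2 * y)^-1 * expR (2 * y * t).
have dF t : is_derive t (1 : R) F (expR (2 * y * t)).
  by apply: is_derive_eq; rewrite /GRing.scale/=; field.
have cf : continuous (fun t => expR (2 * y * t)).
  move=> t; apply: continuous_comp; first exact: mulrl_continuous.
  exact: continuous_expR.
rewrite (Rintegral_FTC pp cf dF)// /F mulrN (mulrAC 2 y pi).
move: (lt0r_neq0 pi0) y0; generalize (@pi R : R) => p p0 y0.
by field; rewrite p0 y0.
Qed.

(** The antiderivative is at most [2 e^(pi |y|) / |z|] in absolute value on [[-pi, pi]], and the two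
    endpoints double the constant. *)
Lemma Rintegral_kern_le x y th (a b : R) : - pi <= a -> a <= b -> b <= pi ->
  0 < x ^+ 2 + y ^+ 2 ->
  `|\int[mu]_(t in `[a, b]) kern x y th t| <=
    4 * expR (pi * `|y|) / Num.sqrt (x ^+ 2 + y ^+ 2).
Proof.
move=> pa ab bp; set r2 := x ^+ 2 + y ^+ 2 => r20.
set r := Num.sqrt r2.
have r0 : 0 < r by rewrite sqrtr_gt0.
have rr : r ^+ 2 = r2 by rewrite sqr_sqrtr ?ltW.
(* The real part of [e^((y + ix)t + i th) / (y + ix)]. *)
pose F t := r2^-1 *
  (expR (y * t) * (y * cos (x * t + th) + x * sin (x * t + th))).
have dF t : is_derive t (1 : R) F (kern x y th t).
  apply: is_derive_eq; rewrite /GRing.scale/= /kern /r2; field.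
  by rewrite gt_eqF.
rewrite (Rintegral_FTC ab (@continuous_kern x y th) dF).
have xr : `|x| <= r.
  by rewrite -sqrtr_sqr ler_sqrt ?(ltW r20)// /r2 lerDl sqr_ge0.
have yr : `|y| <= r.
  by rewrite -sqrtr_sqr ler_sqrt ?(ltW r20)// /r2 lerDr sqr_ge0.
have FE t : - pi <= t -> t <= pi -> `|F t| <= 2 * expR (pi * `|y|) / r.
  move=> t1 t2; rewrite /F normrM normfV (gtr0_norm r20) normrM.
  rewrite (gtr0_norm (expR_gt0 _)).
  have E : expR (y * t) <= expR (pi * `|y|).
    rewrite ler_expR mulrC (le_trans (ler_norm _))// normrM ler_wpM2r//.
    by rewrite ler_norml t1 t2.
  have T : `|y * cos (x * t + th) + x * sin (x * t + th)| <= 2 * r.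
    rewrite (le_trans (ler_normD _ _))// mulr2n mulrDl mul1r !normrM lerD//.
      by rewrite (le_trans _ yr)// ler_piMr// ler_norml cos_geN1 cos_le1.
    by rewrite (le_trans _ xr)// ler_piMr// ler_norml sin_geN1 sin_le1.
  have -> : 2 * expR (pi * `|y|) / r = r2^-1 * (expR (pi * `|y|) * (2 * r)).
    by rewrite -rr; field; rewrite gt_eqF.
  by rewrite ler_wpM2l ?invr_ge0 ?(ltW r20)// ler_pM// expR_ge0.
rewrite (le_trans (ler_normB _ _))//.
have -> : 4 * expR (pi * `|y|) / r =
  2 * expR (pi * `|y|) / r + 2 * expR (pi * `|y|) / r by ring.
by rewrite lerD// FE// ?(le_trans pa)// (le_trans ab).
Qed.
End Kernel.

(** * Square-integrable functions and closure properties of [vanishing] *)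

Section SquareIntegrable.
Context {R : realType}.
Implicit Types (x y t th : R) (u v w : R -> R).
Local Notation mu := (@lebesgue_measure R).
Local Notation Ipi := (`[- pi, pi]%classic : set R).

Definition sqint u := measurable_fun Ipi u /\
  mu.-integrable Ipi (EFin \o (fun t => u t ^+ 2)).

(* [R] carries two convertible measurable structures, with distinct displays;
   [lebesgue_measure] is defined on the one of [measurableTypeR R]. *)
Let mIpi : measurable (Ipi : set (measurableTypeR R)).
Proof. exact: measurable_itv. Qed.

Lemma sqint_le u v : measurable_fun Ipi v ->
  (forall t, Ipi t -> `|v t| <= `|u t|) -> sqint u -> sqint v.
Proof.
move=> mv vu [mfu iu]; split => //.
apply: le_integrable iu => //.
  by apply/measurable_EFinP; exact: measurable_funX.
move=> t It /=; rewrite lee_fin !ger0_norm ?sqr_ge0//.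
rewrite -(real_normK (num_real (v t))) -(real_normK (num_real (u t))).
by rewrite lerXn2r ?nnegrE// vu.
Qed.

Lemma continuous_sqint u : continuous u -> sqint u.
Proof.
move=> cu; split.
  by apply: measurable_funTS; exact: continuous_measurable_fun.
apply: continuous_compact_integrable; first exact: segment_compact.
by apply: continuous_subspaceT => t; rewrite /=; apply: cvgM; exact: cu.
Qed.

(** Domination by [u^2 + v^2]: both signs of [u v] are controlled by [(u + v)^2 >= 0] and
    [(u - v)^2 >= 0]. *)
Lemma sqintM u v : sqint u -> sqint v ->
  mu.-integrable Ipi (EFin \o (fun t => u t * v t)).
Proof.
move=> [mfu iu] [mv iv].
have iuv := integrableD mIpi iu iv; apply: le_integrable iuv => //.
  by apply/measurable_EFinP; exact: measurable_funM.
move=> t It /=; rewrite lee_fin [leRHS]ger0_norm ?addr_ge0 ?sqr_ge0//.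
rewrite ler_norml; apply/andP; split.
  by have := sqr_ge0 (u t + v t); rewrite sqrrD; nra.
by have := sqr_ge0 (u t - v t); rewrite sqrrB; nra.
Qed.

Lemma sqintZ c u : sqint u -> sqint (fun t => c * u t).
Proof.
move=> [mfu iu]; split; first exact: measurable_funM.
have := integrableZl mIpi (c ^+ 2) iu; apply: eq_integrable => // t _ /=.
by rewrite exprMn EFinM.
Qed.

Lemma sqintD u v : sqint u -> sqint v -> sqint (fun t => u t + v t).
Proof.
move=> su sv; split; first by apply: measurable_funD; [case: su|case: sv].
have iuv := integrableZl mIpi 2 (sqintM su sv).
have := integrableD mIpi (integrableD mIpi (proj2 su) (proj2 sv)) iuv.
apply: eq_integrable => // t _ /=.
by rewrite -EFinM -!EFinD; congr EFin; ring.
Qed.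

Lemma sqint_kern x y th : sqint (kern x y th).
Proof. by apply: continuous_sqint => t; exact: continuous_kern. Qed.

(* AM-GM in place of Cauchy-Schwarz: [|w k| <= l w^2 + k^2 / l],
   with [l = sqrt (sinhc y) / e]. *)
Lemma Rintegral_mul_kern_le w x y th e : sqint w -> 0 < e ->
  \int[mu]_(t in Ipi) (w t ^+ 2) <= e ^+ 2 ->
  `|\int[mu]_(t in Ipi) (w t * kern x y th t)| <=
    e * (1 + 2 * pi) * Num.sqrt (sinhc y).
Proof.
move=> sw e0 we.
set s := Num.sqrt (sinhc y).
have s0 : 0 < s by rewrite sqrtr_gt0 sinhc_gt0.
have ss : s ^+ 2 = sinhc y by rewrite sqr_sqrtr// ltW// sinhc_gt0.
have iwk := sqintM sw (sqint_kern x y th).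
have iE : mu.-integrable Ipi (EFin \o (fun t => expR (2 * y * t))).
  apply: continuous_compact_integrable; first exact: segment_compact.
  apply: continuous_subspaceT => t.
  by apply: continuous_comp; [exact: mulrl_continuous|exact: continuous_expR].
have iw := proj2 sw.
pose l := s / e; have l0 : 0 < l by rewrite divr_gt0.
have i1 : mu.-integrable Ipi (EFin \o (fun t => l * w t ^+ 2)).
  by have := integrableZl mIpi l iw; apply: eq_integrable.
have i2 : mu.-integrable Ipi (EFin \o (fun t => l^-1 * expR (2 * y * t))).
  by have := integrableZl mIpi l^-1 iE; apply: eq_integrable.
rewrite (le_trans (le_normr_Rintegral mIpi iwk))//.
apply: (@le_trans _ _
  (\int[mu]_(t in Ipi) (l * w t ^+ 2 + l^-1 * expR (2 * y * t)))).
  apply: le_Rintegral => //.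
  - exact: integrable_norm.
  - by have := integrableD mIpi i1 i2; apply: eq_integrable.
  move=> t _; rewrite normrM.
  have kE : `|kern x y th t| <= expR (y * t).
    rewrite normrM ger0_norm ?expR_ge0// ler_piMr ?expR_ge0//.
    by rewrite ler_norml cos_geN1 cos_le1.
  have -> : expR (2 * y * t) = expR (y * t) ^+ 2.
    by rewrite -mulrA expRM_natl.
  apply: le_trans (_ : `|w t| * expR (y * t) <= _); first by rewrite ler_wpM2l.
  (* Multiplied by [l], the claim is [p q <= p^2 + q^2] with [p = l |w t|] and [q = e^(yt)]. *)
  rewrite -(ler_pM2l l0) -(real_normK (num_real (w t))) mulrDr.
  rewrite (mulrA l l^-1) mulfV ?gt_eqF// mul1r.
  have := sqr_ge0 (l * `|w t| - expR (y * t)).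
  have : 0 <= l * (`|w t| * expR (y * t)).
    by rewrite mulr_ge0 ?(ltW l0)// mulr_ge0// expR_ge0.
  set E := expR _; set W := `|w t|.
  by rewrite sqrrB -subr_ge0; lra.
rewrite RintegralD// RintegralZl// RintegralZl// Rintegral_expR2 -ss.
(* The choice of [l] balances the two terms: they equal [e s] and [2 pi e s]. *)
have -> : e * (1 + 2 * pi) * s = l * e ^+ 2 + l^-1 * (2 * pi * s ^+ 2).
  by rewrite /l; generalize (@pi R : R) => p; field; rewrite !gt_eqF.
by rewrite lerD2r ler_wpM2l// ltW.
Qed.

(** The integral is [o(sqrt (sinhc y))] uniformly in the phase: [th] is quantified after [z], so
    that the cosine and sine integrals are small at the same [z]. *)
Definition vanishing u := forall e : R, 0 < e -> \forall z \near cinfty,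
  forall th,
  `|\int[mu]_(t in Ipi) (u t * kern (complex.Re z) (complex.Im z) th t)|
    <= e * Num.sqrt (sinhc (complex.Im z)).

Lemma vanishingD u v : sqint u -> sqint v -> vanishing u -> vanishing v ->
  vanishing (fun t => u t + v t).
Proof.
move=> su sv hu hv e e0; have e20 : 0 < e / 2 by rewrite divr_gt0.
apply: filterS2 (hu _ e20) (hv _ e20) => z hz1 hz2 th.
under eq_Rintegral do rewrite mulrDl.
rewrite RintegralD//; [|exact: sqintM su (sqint_kern _ _ _)|
  exact: sqintM sv (sqint_kern _ _ _)].
rewrite (le_trans (ler_normD _ _))//.
by rewrite (le_trans (lerD (hz1 th) (hz2 th)))// -mulrDl -splitr.
Qed.

Lemma vanishingZ c u : sqint u -> vanishing u -> vanishing (fun t => c * u t).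
Proof.
move=> su hu e e0; have c0 : 0 < 1 + `|c| by rewrite ltr_wpDr.
(* Dividing by [1 + |c|] instead of [|c|] covers [c = 0]. *)
have d0 : 0 < e / (1 + `|c|) by rewrite divr_gt0.
apply: filterS (hu _ d0) => z hz th.
under eq_Rintegral do rewrite -mulrA.
rewrite RintegralZl//; last exact: sqintM su (sqint_kern _ _ _).
rewrite normrM (le_trans (ler_wpM2l _ (hz th)))// mulrA ler_wpM2r ?sqrtr_ge0//.
by rewrite mulrCA ler_piMr ?(ltW e0)// ler_pdivrMr// mul1r lerDr.
Qed.

(** [Rintegral_mul_kern_le] makes the contribution of [u - v] at most [e / 2] times the weight for
    every [z] and [th], so only [v] restricts [z]. *)
Lemma vanishing_closed u : sqint u ->
  (forall e : R, 0 < e -> exists v, [/\ sqint v, vanishing v &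
    \int[mu]_(t in Ipi) ((u t - v t) ^+ 2) <= e ^+ 2]) ->
  vanishing u.
Proof.
move=> su H e e0.
have p0 : 0 < 1 + 2 * pi :> R by rewrite ltr_wpDr// mulr_ge0// ltW// pi_gt0.
have d0 : 0 < e / 2 / (1 + 2 * pi) by rewrite !divr_gt0.
have [v [sv hv uv]] := H _ d0.
have e20 : 0 < e / 2 by rewrite divr_gt0.
apply: filterS (hv _ e20) => z hz th.
have sw : sqint (fun t => u t - v t).
  have := sqintD su (sqintZ (-1) sv).
  by under [X in sqint X -> _]eq_fun do rewrite mulN1r.
have -> : \int[mu]_(t in Ipi) (u t * kern (complex.Re z) (complex.Im z) th t) =
  \int[mu]_(t in Ipi) ((u t - v t) * kern (complex.Re z) (complex.Im z) th t) +
  \int[mu]_(t in Ipi) (v t * kern (complex.Re z) (complex.Im z) th t).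
  rewrite -RintegralD//; [|exact: sqintM sw (sqint_kern _ _ _)|
    exact: sqintM sv (sqint_kern _ _ _)].
  by apply: eq_Rintegral => t _; rewrite -mulrDl subrK.
rewrite (le_trans (ler_normD _ _))//.
have := Rintegral_mul_kern_le (complex.Re z) (complex.Im z) th sw d0 uv.
rewrite divfK ?gt_eqF// => h.
by rewrite (le_trans (lerD h (hz th)))// -mulrDl -splitr.
Qed.

(** Since [|u - v n| <= 2 |u|], the function [4 u^2] dominates [(u - v n)^2]; dominated convergence
    gives L^2 convergence, and [vanishing_closed] applies. *)
Lemma vanishing_lim u (v : (R -> R)^nat) : sqint u ->
  (forall n, sqint (v n)) -> (forall n, vanishing (v n)) ->
  (forall n t, Ipi t -> `|v n t| <= `|u t|) ->
  (forall t, Ipi t -> v ^~ t @ \oo --> u t) -> vanishing u.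
Proof.
move=> su sv hv vu cvu; apply: vanishing_closed => // e e0.
have sw n : sqint (fun t => u t - v n t).
  have := sqintD su (sqintZ (-1) (sv n)).
  by under [X in sqint X -> _]eq_fun do rewrite mulN1r.
have [] := @dominated_convergence _ _ _ mu Ipi mIpi
  (fun n => EFin \o (fun t => (u t - v n t) ^+ 2)) (cst 0%E)
  (fun t => 4%:E * (u t ^+ 2)%:E)%E.
- by move=> n; exact: measurable_int (proj2 (sw n)).
- exact: measurable_cst.
- apply: aeW => t It; apply/fine_cvgP; split; first by apply: nearW.
  have c : (fun n => u t - v n t) @ \oo --> (0 : R).
    by rewrite -(subrr (u t)); apply: cvgB; [exact: cvg_cst|exact: cvu].
  by have := cvgM c c; rewrite mulr0; apply.
- exact: integrableZl (proj2 su).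
- apply: aeW => t n It /=; rewrite -EFinM lee_fin ger0_norm ?sqr_ge0//.
  rewrite -(real_normK (num_real (_ - _))) -(real_normK (num_real (u t))).
  have := ler_normB (u t) (v n t); have := vu n t It.
  have := normr_ge0 (u t); have := normr_ge0 (u t - v n t).
  set a := `|_ - _|; set b := `|u t|; set c := `|_| => a0 b0 cb ab.
  nra.
move=> _ _; rewrite integral0 => /fine_cvgP[_].
move=> /cvgrPdist_le /(_ (e ^+ 2)) []; first by rewrite exprn_gt0.
move=> N _ /(_ N (leqnn N)) /=; rewrite sub0r normrN => h.
by exists (v N); split => //; exact: le_trans (ler_norm _) h.
Qed.

End SquareIntegrable.

(** * From rays to all square-integrable functions *)

Section Density.
Context {R : realType}.
Implicit Types (x y t th : R) (u v w : R -> R).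
Local Notation mu := (@lebesgue_measure R).
Local Notation Ipi := (`[- pi, pi]%classic : set R).

Let mIpi : measurable (Ipi : set (measurableTypeR R)).
Proof. exact: measurable_itv. Qed.

Lemma near_expR_div_cmod_le (e : R) : 0 < e -> \forall z \near @cinfty R,
  0 < cmod z /\ 4 * expR (pi * `|complex.Im z|) / cmod z
    <= e * Num.sqrt (sinhc (complex.Im z)).
Proof.
move=> e0; have pi0 := @pi_gt0 R.
(* After squaring, the goal is [16 e^(2 pi |y|) <= e^2 sinhc y r^2]. The bound [r > 1] gives
   [1 + 4 pi |y| <= (1 + 4 pi) r], and the second bound absorbs [16 (1 + 4 pi) r] into [e^2 r^2]. *)
exists (Num.max 1 (16 * (1 + 4 * pi) / e ^+ 2)) => // -[x y] /=.
rewrite gt_max; set r := Num.sqrt _ => /andP[r1 rM].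
have r0 : 0 < r by rewrite (lt_trans _ r1).
split=> //; have S0 := sinhc_gt0 y; have lb := sinhc_lower_bound y.
have yr : `|y| <= r.
  by rewrite -sqrtr_sqr ler_sqrt ?addr_ge0 ?sqr_ge0// lerDr sqr_ge0.
rewrite ler_pdivrMr//.
have le0 : 0 <= e * Num.sqrt (sinhc y) * r.
  by rewrite !mulr_ge0 ?sqrtr_ge0 ?ltW.
rewrite -(@ler_pXn2r _ 2)// ?nnegrE ?mulr_ge0 ?expR_ge0//.
rewrite !exprMn sqr_sqrtr ?(ltW S0)// -expRM_natl.
move: rM; rewrite ltr_pdivrMr ?exprn_gt0// => rM.
have h1 : sinhc y * (1 + 4 * pi * `|y|) <= sinhc y * ((1 + 4 * pi) * r).
  have -> : (1 + 4 * pi) * r = r + 4 * pi * r by ring.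
  rewrite ler_wpM2l ?(ltW S0)// lerD ?(ltW r1)//.
  by rewrite ler_wpM2l// mulr_ge0// ltW.
have h2 : 16 * (sinhc y * ((1 + 4 * pi) * r)) <= e ^+ 2 * sinhc y * r ^+ 2.
  have -> : 16 * (sinhc y * ((1 + 4 * pi) * r)) =
    sinhc y * r * (16 * (1 + 4 * pi)) by ring.
  have -> : e ^+ 2 * sinhc y * r ^+ 2 = sinhc y * r * (r * e ^+ 2) by ring.
  by rewrite ler_wpM2l ?(ltW rM)// mulr_ge0 ?(ltW S0)// ltW.
have -> : 4 ^+ 2 = 16 :> R by ring.
by rewrite (le_trans _ h2)// ler_wpM2l// (le_trans lb h1).
Qed.

Lemma Rintegral_indicM (A : set R) u :
  \int[mu]_(t in Ipi) (\1_A t * u t) = \int[mu]_(t in Ipi `&` A) u t.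
Proof.
rewrite Rintegral_mkcondr; apply: eq_Rintegral => t _.
by rewrite patchE indicE; case: ifP => _; rewrite ?mul1r ?mul0r.
Qed.

(** The ray meets [[-pi, pi]] in everything, in nothing or in []a, pi]]; [Rintegral_kern_le] handles
    the nonempty cases. *)
Lemma vanishing_indic_ray (a : R) : vanishing (\1_(`]a, +oo[%classic : set R)).
Proof.
move=> e e0; apply: filterS (near_expR_div_cmod_le e0) => -[x y] /= [].
set r := Num.sqrt _ => r0 rle th.
have r20 : 0 < x ^+ 2 + y ^+ 2 by rewrite -sqrtr_gt0.
have K b : - pi <= b -> b <= pi ->
    `|\int[mu]_(t in `[b, pi]) kern x y th t| <= e * Num.sqrt (sinhc y).
  by move=> b1 b2; apply: le_trans (Rintegral_kern_le th b1 b2 _ r20) rle.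
rewrite Rintegral_indicM.
have [api|pia] := ltP a (- pi).
  rewrite (_ : Ipi `&` _ = Ipi); first by rewrite K// ge0_cp ?pi_ge0.
  apply/seteqP; split => t /=; first by case.
  by rewrite !in_itv/= => /andP[t1 t2]; rewrite t1 t2 (lt_le_trans api t1).
have [pa|ap] := leP pi a.
  rewrite (_ : Ipi `&` _ = set0).
    by rewrite Rintegral_set0 normr0 mulr_ge0 ?sqrtr_ge0// ltW.
  apply/seteqP; split => t //=; rewrite !in_itv/= andbT => -[/andP[t1 t2] t3].
  by have := le_lt_trans pa t3; rewrite ltNge t2.
rewrite (_ : Ipi `&` _ = `]a, pi]%classic).
  rewrite Rintegral_itv_obnd_cbnd ?K// ?ltW//.
  apply: (@integrableS _ _ _ mu `[a, pi]%classic) => //.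
    by apply: subset_itvr; rewrite bnd_simp.
  apply: continuous_compact_integrable; first exact: segment_compact.
  by apply: continuous_subspaceT => t; exact: continuous_kern.
apply/seteqP; split => t /=; rewrite !in_itv/= ?andbT.
  by move=> -[/andP[_ ->] ->].
by move=> /andP[t1 t2]; rewrite t1 t2 (le_trans pia (ltW t1)).
Qed.

Lemma sqint_indic (A : set (measurableTypeR R)) : measurable A ->
  sqint (\1_A : R -> R).
Proof.
move=> mA; apply: (@sqint_le _ (cst 1)).
- exact: measurable_indic.
- by move=> t _; rewrite indicE /= normr1 ger0_norm ?ler0n// lern1 leq_b1.
- by apply: continuous_sqint => t; exact: cvg_cst.
Qed.

Lemma vanishing_indic (A : set (measurableTypeR R)) : measurable A ->
  vanishing (\1_A : R -> R).
Proof.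
(* Rays form a pi-system generating the Borel sets, so it suffices that [H] is a lambda-system
   containing them. Measurability is kept in [H] so that the indicators are in [sqint]. *)
pose H := [set A : set (measurableTypeR R) | measurable A /\
  vanishing (\1_A : R -> R)].
suff : @measurable _ (measurableTypeR R) `<=` H by move=> + mA => /(_ _ mA)[].
rewrite RGenOInfty.measurableE; apply: lambda_system_subset => //.
- move=> _ _ [a ->] [b ->]; exists (Num.max a b).
  by apply/seteqP; split => t /=; rewrite !in_itv/= !andbT gt_max => /andP.
- have Hray a : H `]a, +oo[%classic.
    by split; [exact: measurable_itv|exact: vanishing_indic_ray].
  have Hnd : ndseq_closed H.
    move=> F ndF HF; have mF : measurable (\bigcup_i F i).
      by apply: bigcupT_measurable => i; case: (HF i).
    (* The indicators of an increasing sequence are dominated by that of the union and are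
       eventually equal to it at each point. *)
    split=> //; apply: (@vanishing_lim _ _ (fun n => \1_(F n))).
    - exact: sqint_indic.
    - by move=> n; apply: sqint_indic; case: (HF n).
    - by move=> n; case: (HF n).
    - move=> n t _; rewrite !indicE !ger0_norm ?ler0n// ler_nat.
      case: (boolP (t \in F n)) => // /set_mem Ft.
      by rewrite mem_set//; exists n.
    - move=> t _; rewrite indicE; have [/set_mem[n _ Ft]|tF] := boolP (_ \in _).
        apply: cvg_near_cst; exists n => // m nm /=.
        by rewrite indicE mem_set//; move: Ft; apply/subsetPset/ndF.
      apply: cvg_near_cst; apply: nearW => n; rewrite indicE memNset// => Ft.
      by move/negP : tF; apply; apply/mem_set; exists n.
  split => //.
  (* The whole line is an increasing union of rays, so the closure just proved applies. *)
  + rewrite (_ : setT = \bigcup_i `](- i%:R), +oo[%classic).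
      apply: Hnd => // m n mn; apply/subsetPset => t /=.
      by rewrite !in_itv/= !andbT; apply: le_lt_trans; rewrite lerN2 ler_nat.
    apply/seteqP; split => // t _; exists (Num.truncn `|t|).+1 => //=.
    rewrite in_itv/= andbT ltrNl (le_lt_trans (ler_norm _))// normrN.
    exact: Num.Theory.truncnS_gt.
  + move=> C B BC [mC hC] [mB hB]; split; first exact: measurableD.
    have -> : \1_(C `\` B) = (fun t => \1_C t + -1 * \1_B t) :> (R -> R).
      apply/funext => t; rewrite !indicE in_setD.
      case: (boolP (t \in B)) => [tB|_].
        by rewrite mem_set ?mulr1 ?subrr//; apply: BC; exact: set_mem.
      by rewrite andbT mulr0 addr0.
    apply: vanishingD => //; [exact: sqint_indic|by apply/sqintZ/sqint_indic|].
    by apply: vanishingZ => //; exact: sqint_indic.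
- by move=> _ [a ->]; split; [exact: measurable_itv|exact: vanishing_indic_ray].
Qed.

Import HBNNSimple.

Lemma vanishing_nnsfun (h : {nnsfun (measurableTypeR R) >-> R}) :
  vanishing (h : R -> R).
Proof.
pose g (s : seq R) t : R := \sum_(y <- s) y * \1_(h @^-1` [set y]) t.
have -> : (h : R -> R) = g (finmap.enum_fset (fset_set (range h))).
  by apply/funext => t; rewrite fimfunE fsbig_finite.
have mh y : measurable (h @^-1` [set y] : set (measurableTypeR R)).
  exact: measurable_sfunP.
have sP y : sqint (\1_(h @^-1` [set y]) : R -> R) by exact: sqint_indic.
(* Generalized to an arbitrary list of values for the induction; [sqint] is carried along because
   [vanishingD] requires it. *)
suff H s : sqint (g s) /\ vanishing (g s).
  by case: (H (finmap.enum_fset (fset_set (range h)))).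
elim: s => [|y s [IH1 IH2]].
  have -> : g [::] = (fun t => 0 * \1_(set0 : set (measurableTypeR R)) t).
    by apply/funext => t; rewrite /g big_nil mul0r.
  split; first by apply/sqintZ/sqint_indic.
  by apply: vanishingZ; [exact: sqint_indic|exact: vanishing_indic].
have -> : g (y :: s) = (fun t => y * \1_(h @^-1` [set y]) t + g s t).
  by apply/funext => t; rewrite /g big_cons.
split; first by apply: sqintD => //; exact: sqintZ.
apply: vanishingD => //; first exact: sqintZ.
by apply: vanishingZ => //; exact: vanishing_indic.
Qed.

(** The standard approximation by nonnegative simple functions lies below [u] and converges
    pointwise on [[-pi, pi]], as [vanishing_lim] demands. *)
Lemma ge0_sqint_vanishing u : sqint u -> (forall t, Ipi t -> 0 <= u t) ->
  vanishing u.
Proof.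
move=> su u0.
have mfu : measurable_fun (Ipi : set (measurableTypeR R)) (EFin \o u).
  by apply/measurable_EFinP; case: su.
pose v n : R -> R := nnsfun_approx mIpi mfu n.
have vu n t : Ipi t -> `|v n t| <= `|u t|.
  move=> It; rewrite /v nnsfun_approxE !ger0_norm ?u0//; last first.
    by rewrite -nnsfun_approxE.
  by rewrite -lee_fin; apply: le_approx => // s Is; rewrite lee_fin u0.
apply: (vanishing_lim su _ _ vu).
- move=> n; apply: (sqint_le _ (vu n) su); apply: measurable_funTS.
  exact: (@measurable_funPT _ _ (measurableTypeR R) R (nnsfun_approx mIpi mfu n)).
- by move=> n; exact: vanishing_nnsfun.
- move=> t It.
  have /= := @cvg_nnsfun_approx _ _ _ _ mIpi _ mfu _ t It.
  by move=> /(_ (fun s Is => u0 s Is)) /fine_cvgP[_].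
Qed.

Lemma sqint_vanishing u : sqint u -> vanishing u.
Proof.
move=> su.
have sn : sqint (fun t => `|u t|).
  apply: (sqint_le _ _ su); first by apply: measurableT_comp => //; case: su.
  by move=> t _; rewrite normr_id.
have sp := sqintD sn su.
have sm := sqintD sn (sqintZ (-1) su).
(* Positive part minus negative part. *)
have -> : u = (fun t => 2^-1 * (`|u t| + u t) + - 2^-1 * (`|u t| + -1 * u t)).
  by apply/funext => t; field.
apply: vanishingD; [exact: sqintZ|exact: sqintZ|apply: vanishingZ => //|
  apply: vanishingZ => //]; apply: ge0_sqint_vanishing => // t _.
- by rewrite -lerBlDr sub0r -normrN ler_norm.
- by rewrite mulN1r subr_ge0 ler_norm.
Qed.

End Density.

(** * Return to complex integrals and the two weights *)

Section Assembly.
Context {R : realType}.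
Implicit Types (x y t th : R) (u v w : R -> R).
Local Notation mu := (@lebesgue_measure R).
Local Notation Ipi := (`[- pi, pi]%classic : set R).

Lemma sqint_Re_Im (F : R -> R[i]) : L2_pi F ->
  sqint (fun t => complex.Re (F t)) /\ sqint (fun t => complex.Im (F t)).
Proof.
move=> [mRe mIm iF].
have cE t : cmod (F t) ^+ 2 = complex.Re (F t) ^+ 2 + complex.Im (F t) ^+ 2.
  by case: (F t) => a b /=; rewrite sqr_sqrtr// addr_ge0 ?sqr_ge0.
have sc : sqint (fun t => cmod (F t)).
  have mc : measurable_fun Ipi (fun t => cmod (F t) ^+ 2).
    rewrite (_ : (fun t => _) =
      (fun t => complex.Re (F t) ^+ 2 + complex.Im (F t) ^+ 2));
      last exact/funext/cE.
    by apply: measurable_funD; exact: measurable_funX.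
  split.
    (* Measurability of the modulus comes from that of its square, a polynomial in the two parts. *)
    have -> : (fun t => cmod (F t)) = Num.sqrt \o (fun t => cmod (F t) ^+ 2).
      apply/funext => t /=; rewrite sqrtr_sqr ger0_norm//.
      by case: (F t) => a b; exact: sqrtr_ge0.
    apply: measurableT_comp => //; apply: continuous_measurable_fun.
    exact: sqrt_continuous.
  apply/integrableP; split; first exact/measurable_EFinP.
  under eq_integral do rewrite gee0_abs ?lee_fin ?sqr_ge0//.
  exact: iF.
have nE t : `|cmod (F t)| = cmod (F t).
  by rewrite ger0_norm//; case: (F t) => a b; exact: sqrtr_ge0.
split; apply: (sqint_le _ _ sc) => // t _; rewrite nE; case: (F t) => a b /=.
  by rewrite -sqrtr_sqr ler_sqrt ?addr_ge0 ?sqr_ge0// lerDl sqr_ge0.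
by rewrite -sqrtr_sqr ler_sqrt ?addr_ge0 ?sqr_ge0// lerDr sqr_ge0.
Qed.

Lemma mul_cexp_kern (w z : R[i]) t :
  w * cexp (- 'i * z * t%:C) =
    (complex.Re w * kern (complex.Re z) (complex.Im z) 0 t
     + complex.Im w * kern (complex.Re z) (complex.Im z) (- (pi / 2)) t) +i*
    (complex.Im w * kern (complex.Re z) (complex.Im z) 0 t
     - complex.Re w * kern (complex.Re z) (complex.Im z) (- (pi / 2)) t).
Proof.
case: w z => [u v] [x y]; rewrite /kern addr0 [complex.Re _]/= [complex.Im _]/=.
have -> : cos (x * t - pi / 2) = sin (x * t).
  by rewrite -[in RHS](subrK (pi / 2) (x * t)) sinDpihalf.
have -> : - 'i * (x +i* y) * t%:C = (y * t) +i* (- (x * t)).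
  by simpc; congr Complex; ring.
rewrite /cexp cosN sinN; simpc; congr Complex => /=; ring.
Qed.

Lemma paley_wiener_near (f : R[i] -> R[i]) (e : R) : paley_wiener f -> 0 < e ->
  \forall z \near cinfty, cmod (f z) / Num.sqrt (sinhc (complex.Im z)) <= e.
Proof.
move=> [F /sqint_Re_Im[su sv] fE] e0.
(* Four real integrals arise: each part of [F] against each of the two phases. *)
have e40 : 0 < e / 4 by rewrite divr_gt0.
apply: filterS2 (sqint_vanishing su e40) (sqint_vanishing sv e40) => z hu hv.
rewrite ler_pdivrMr ?sqrtr_gt0 ?sinhc_gt0//.
set x := complex.Re z in hu hv *; set y := complex.Im z in hu hv *.
rewrite fE ComplexField.Normc.normcM /cintegral.
have -> : \int[mu]_(t in Ipi) complex.Re (F t * cexp (- 'i * z * t%:C)) =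
    \int[mu]_(t in Ipi) (complex.Re (F t) * kern x y 0 t) +
    \int[mu]_(t in Ipi) (complex.Im (F t) * kern x y (- (pi / 2)) t).
  under eq_Rintegral do rewrite mul_cexp_kern /=.
  by rewrite RintegralD//; apply: sqintM => //; exact: sqint_kern.
have -> : \int[mu]_(t in Ipi) complex.Im (F t * cexp (- 'i * z * t%:C)) =
    \int[mu]_(t in Ipi) (complex.Im (F t) * kern x y 0 t) -
    \int[mu]_(t in Ipi) (complex.Re (F t) * kern x y (- (pi / 2)) t).
  under eq_Rintegral do rewrite mul_cexp_kern /=.
  by rewrite RintegralB//; apply: sqintM => //; exact: sqint_kern.
move: (hu 0) (hu (- (pi / 2))) (hv 0) (hv (- (pi / 2))).
set a := Rintegral _ _ _; set b := Rintegral _ _ _.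
set c := Rintegral _ _ _; set d := Rintegral _ _ _ => ha hb hc hd.
set s := Num.sqrt (sinhc y) in ha hb hc hd *.
have cR (r : R) : cmod r%:C = `|r| by rewrite /= expr0n addr0 sqrtr_sqr.
have cI (r : R) : cmod (0 +i* r) = `|r| by rewrite /= expr0n add0r sqrtr_sqr.
have cD : cmod ((a + d) +i* (c - b)) <= e * s.
  (* The modulus is bounded by the sum of the absolute values of the two parts. *)
  have -> : (a + d) +i* (c - b) = (a + d)%:C + (0 +i* (c - b)).
    by simpc.
  rewrite (le_trans (le_normcD _ _))// cR cI.
  have := ler_normD a d; have := ler_normB c b.
  have -> : e * s = (e / 4) * s + (e / 4) * s + ((e / 4) * s + (e / 4) * s).
    by field.
  lra.
rewrite cR ger0_norm; last first.
  by rewrite invr_ge0 mulr_ge0// pi_ge0.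
(* The factor [1 / (2 pi)] is simply bounded by 1. *)
rewrite -[leRHS]mul1r ler_pM ?invr_ge0 ?mulr_ge0 ?pi_ge0 ?sqrtr_ge0//.
rewrite invf_le1 ?mulr_gt0 ?pi_gt0//.
have := @pi_ge2 R; lra.
Qed.

(** Here [z - z^* = 2iy], and [sin (i s) = i sinh s]; the two limits thus concern the same
    quotient. *)
Lemma csinc_subJ (z : R[i]) : csinc (z - z^*) = (sinhc (complex.Im z))%:C.
Proof.
case: z => x y; have pi0 := lt0r_neq0 (@pi_gt0 R).
have -> : (x +i* y) - (x +i* y)^* = 0 +i* (2 * y).
  by simpc; congr Complex; ring.
rewrite /csinc /sinhc eq_complex /= eqxx mulf_eq0 pnatr_eq0 /=.
have [//|y0] := eqVneq y 0.
rewrite /csin.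
have -> : pi%:C * (0 +i* (2 * y)) = 0 +i* (2 * pi * y).
  by simpc; congr Complex; ring.
set I : R[i] := Num.imaginary.
have -> : I * (0 +i* (2 * pi * y)) = (- (2 * pi * y))%:C by rewrite /I; simpc.
have E (r : R) : cexp r%:C = (expR r)%:C by rewrite /cexp /= cos0 sin0; simpc.
have CN (a : R) : - a%:C = (- a)%:C by rewrite rmorphN.
have CB (a b : R) : a%:C - b%:C = (a - b)%:C by rewrite rmorphB.
rewrite CN opprK !E CB.
have -> : 0 +i* (2 * pi * y) = I * (2 * pi * y)%:C by rewrite /I; simpc.
have i0 : I != 0 by exact: neq0Ci.
have -> : (2 : R[i]) = (2 : R)%:C by rewrite rmorphD rmorph1.
have c0 : (2 * pi * y)%:C != 0 by rewrite fmorph_eq0 !mulf_neq0.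
have d0 : (2 : R)%:C != 0 by rewrite fmorph_eq0.
have ii : I * I = -1 by rewrite -expr2 sqrCi.
set A := expR _; set B := expR _.
transitivity ((B - A)%:C / ((2 : R)%:C * (2 * pi * y)%:C)).
  (* Writing the sign as [i^2] cancels the two factors [i] of the denominator, one from [csin] and
     one from its argument. *)
  have -> : (A - B)%:C = I * I * (B - A)%:C by rewrite ii mulN1r CN opprB.
  move: c0 d0 i0; generalize ((2 * pi * y)%:C) ((2 : R)%:C) ((B - A)%:C) I.
  by move=> p q r s c0 d0 i0; field; rewrite c0 d0 i0.
have -> : (2 : R)%:C * (2 * pi * y)%:C = (4 * pi * y)%:C.
  by rewrite -[LHS]rmorphM; congr _%:C; ring.
by rewrite [RHS]rmorphM [X in _ = _ * X]fmorphV.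
Qed.

End Assembly.

Unset Implicit Arguments.
Set Strict Implicit.

Theorem lemma3p4 (R : realType) (f : R[i] -> R[i]) (hf : paley_wiener f) :
  (`|f z| / sqrtc (csinc (z - z^*)) : R[i]^o) @[z --> cinfty] --> (0 : R[i]^o) /\
  cmod (f z) / Num.sqrt (sinhc (complex.Im z)) @[z --> cinfty] --> (0 : R).
Proof.
have S0 (z : R[i]) : 0 < sinhc (complex.Im z) by exact: sinhc_gt0.
have c0 (z : R[i]) : 0 <= cmod (f z) / Num.sqrt (sinhc (complex.Im z)).
  rewrite divr_ge0 ?sqrtr_ge0//; case: (f z) => a b; exact: sqrtr_ge0.
split.
  have -> : (fun z => `|f z| / sqrtc (csinc (z - z^*)) : R[i]^o) =
      (fun z => (cmod (f z) / Num.sqrt (sinhc (complex.Im z)))%:C : R[i]^o).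
    apply/funext => z; rewrite csinc_subJ sqrtc_sqrtr ?lecR ?ltW//.
    by rewrite rmorphM fmorphV.
  (* A positive element of [R[i]] has zero imaginary part, so the tolerance is a positive real. *)
  apply/cvgr0Pnorm_le => -[e e'] /[!ltcE] /= /andP[/eqP -> e0].
  apply: filterS (paley_wiener_near hf e0) => z hz.
  by rewrite ger0_norm ?lecR.
apply/cvgr0Pnorm_le => e e0; apply: filterS (paley_wiener_near hf e0) => z hz.
by rewrite ger0_norm.
Qed.
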